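(* Let $k\ge1$ and let $x\in\tilde S_{k+1}$ be an affine permutation. Then $\mathrm{RD}(x)$ is a permutation of $\mathrm{LD}(x)$, and $\mathrm{RI}(x)$ is a permutation of $\mathrm{LI}(x)$ (that is, the vectors have the same entries up to reordering).
   Context: Fix $k\ge1$, $I=\mathbb Z/(k+1)\mathbb Z$. $\tilde S_{k+1}$ is the affine symmetric group with simple generators $s_i$, $i\in I$. The affine nil-Coxeter monoid is generated by $a_i$ ($i\in I$) and an absorbing zero, with relations $a_i^2=0$, $a_ia_j=a_ja_i$ for $j\notin\{i-1,i,i+1\}$, and (for $k\ge2$) $a_ia_{i+1}a_i=a_{i+1}a_ia_{i+1}$; its nonzero elements are identified with affine permutations via reduced words. For $A\subsetneq I$, $d_A$ (resp. $u_A$) is the product of the $a_i$, $i\in A$, each once, with $a_j$ to the left (resp. right) of $a_{j-1}$ whenever $j,j-1\in A$. For an affine permutation $x$ there are four canonical decompositions into nonempty proper subsets of $I$, each unique: right decreasing: $x=d_{A_n}\cdots d_{A_1}$ with $(|A_1|,\dots,|A_n|)$ lexicographically maximal; right increasing: $x=u_{B_m}\cdots u_{B_1}$ with $(|B_1|,\dots,|B_m|)$ lexicographically maximal; left decreasing: $x=d_{C_1}d_{C_2}\cdots d_{C_r}$ with $(|C_1|,\dots,|C_r|)$ lexicographically maximal; left increasing: $x=u_{E_1}u_{E_2}\cdots u_{E_t}$ with $(|E_1|,\dots,|E_t|)$ lexicographically maximal. They satisfy $A_{j+1}\subset A_j-1$, $B_{j+1}\subset B_j+1$, $C_{j+1}\subset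 C_j+1$, $E_{j+1}\subset E_j-1$ (where $S\pm1=\{s\pm1:s\in S\}$). The associated $k$-codes (vectors in $\mathbb Z_{\ge0}^{I}$ with at least one zero entry) are $\mathrm{RD}(x)_i=\#\{j\ge 1: i-(j-1)\in A_j\}$, $\mathrm{RI}(x)_i=\#\{j\ge1: i+(j-1)\in B_j\}$, $\mathrm{LD}(x)_i=\#\{j\ge1: i+(j-1)\in C_j\}$, $\mathrm{LI}(x)_i=\#\{j\ge1: i-(j-1)\in E_j\}$. *)

(* Defs.v *)
From HB Require Import structures.
From mathcomp Require Import all_boot all_order all_algebra.
From mathcomp Require classical_sets.

Set Implicit Arguments.
Unset Strict Implicit.
Unset Printing Implicit Defensive.

Import Order.TTheory GRing.Theory Num.Theory.
Local Open Scope ring_scope.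

(* The index set Z/(k+1)Z.  'Z_1 is Z/2Z, so everything below is meaningful
   only for k >= 1. *)
Notation Idx k := 'Z_k.+1.

Record affine_permutation (k : nat) := AffinePermutation {
  affine_fun :> int -> int;
  affine_bij : bijective affine_fun;
  affine_periodic : forall m : int, affine_fun (m + k.+1%:Z) = affine_fun m + k.+1%:Z;
  affine_sum : \sum_(1 <= i < k.+2) affine_fun i%:Z = \sum_(1 <= i < k.+2) i%:Z
}.

(* s_i exchanges m and m + 1 for every integer m congruent to i. *)
Definition simple_refl (k : nat) (i : Idx k) (m : int) : int :=
  if m%:~R == i then m + 1 else if m%:~R == i + 1 then m - 1 else m.

(* The word i_1 ... i_l denotes the composite s_(i_1) \o ... \o s_(i_l). *)
Definition word_fun (k : nat) (w : seq (Idx k)) : int -> int :=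
  foldr (fun i f => simple_refl i \o f) id w.

Definition reduced_word (k : nat) (x : affine_permutation k) (w : seq (Idx k)) : Prop :=
  word_fun w =1 x /\
  forall w' : seq (Idx k), word_fun w' =1 x -> (size w <= size w')%N.

(* The free monoid with zero on the generators a_i: Some w is the product of
   the a_i along the word w, None is the absorbing zero. *)
Definition mul0w (k : nat) (u v : option (seq (Idx k))) : option (seq (Idx k)) :=
  if u is Some a then if v is Some b then Some (a ++ b) else None else None.

Inductive nilcox_rel (k : nat) :
    option (seq (Idx k)) -> option (seq (Idx k)) -> Prop :=
| NilSquare (i : Idx k) : nilcox_rel (Some [:: i; i]) None
| NilCommute (i j : Idx k) :
    j \notin [:: i - 1; i; i + 1] ->
    nilcox_rel (Some [:: i; j]) (Some [:: j; i])
| NilBraid (i : Idx k) :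
    (2 <= k)%N ->
    nilcox_rel (Some [:: i; i + 1; i]) (Some [:: i + 1; i; i + 1]).

(* The monoid congruence generated by nilcox_rel: equality in the affine
   nil-Coxeter monoid. *)
Inductive nilcox_eq (k : nat) :
    option (seq (Idx k)) -> option (seq (Idx k)) -> Prop :=
| NilRel u v : nilcox_rel u v -> nilcox_eq u v
| NilRefl u : nilcox_eq u u
| NilSym u v : nilcox_eq u v -> nilcox_eq v u
| NilTrans u v w : nilcox_eq u v -> nilcox_eq v w -> nilcox_eq u w
| NilMul u u' v v' :
    nilcox_eq u u' -> nilcox_eq v v' -> nilcox_eq (mul0w u v) (mul0w u' v').

(* x, identified with the class of its reduced words, equals the product of the
   a_i along w in the affine nil-Coxeter monoid. *)
Definition equals_product (k : nat) (x : affine_permutation k) (w : seq (Idx k)) : Prop :=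
  exists r : seq (Idx k), reduced_word x r /\ nilcox_eq (Some r) (Some w).

(* With z a missing index, A is listed along z + k, ..., z + 2, z + 1; the junk
   value [::] is taken when A is the whole index set. *)
Definition dec_word (k : nat) (A : {set Idx k}) : seq (Idx k) :=
  if [pick z | z \notin A] is Some z
  then [seq j <- [seq z + i | i <- rev (enum {: Idx k})] | j \in A]
  else [::].

Definition inc_word (k : nat) (A : {set Idx k}) : seq (Idx k) := rev (dec_word A).

Lemma dec_word_perm (k : nat) (A : {set Idx k}) :
  A \proper [set: Idx k] -> perm_eq (dec_word A) (enum A).
Proof.
case/properP=> _ [z0 _ z0A]; rewrite /dec_word; case: pickP => [z zA|/(_ z0)]; last first.
  by rewrite z0A.
apply: uniq_perm; rewrite ?enum_uniq //.
  by rewrite filter_uniq // map_inj_uniq ?rev_uniq ?enum_uniq //; apply: addrI.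
move=> j; rewrite mem_filter mem_enum; case: (j \in A) => //=.
by apply/mapP; exists (j - z); rewrite ?mem_rev ?mem_enum ?inE // addrC subrK.
Qed.

Lemma dec_word_order (k : nat) (A : {set Idx k}) (j : Idx k) :
  A \proper [set: Idx k] -> j \in A -> j - 1 \in A ->
  (index j (dec_word A) < index (j - 1)%R (dec_word A))%N.
Proof.
move=> Apr jA j1A.
have mem i : (i \in dec_word A) = (i \in A).
  by rewrite (perm_mem (dec_word_perm Apr)) mem_enum.
have jN : j != j - 1 by rewrite eq_sym -subr_eq0 addrAC subrr add0r oppr_eq0 oner_eq0.
rewrite ltnNge leq_eqVlt; apply/norP; split.
  apply: contraNN jN => /eqP /(congr1 (nth j (dec_word A))).
  by rewrite !nth_index ?mem // => ->.
have [z zA srt] : exists2 z, z \notin A &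
    sorted (fun a b : Idx k => (val (b - z)%R < val (a - z)%R)%N) (dec_word A).
  case/properP: Apr => _ [z0 _ z0A]; rewrite /dec_word.
  case: pickP => [z zA|/(_ z0)]; last by rewrite z0A.
  exists z => //; apply: sorted_filter => [a b c /= ab bc|]; first exact: ltn_trans bc ab.
  rewrite sorted_map (@eq_sorted _ _ (fun a b : Idx k => (val b < val a)%N)) => [|a b].
    rewrite rev_sorted (@eq_sorted _ _ (relpre val ltn)) // -sorted_map.
    by rewrite val_enum_ord iota_ltn_sorted.
  have zK c : z + c - z = c by rewrite addrC addKr.
  by rewrite -{2}(zK a) -{2}(zK b).
apply/negP => idx.
have tr : transitive (fun a b : Idx k => (val (b - z)%R < val (a - z)%R)%N).
  by move=> b a c ab bc; apply: ltn_trans bc ab.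
have := sorted_ltn_index tr srt; move/(_ (j - 1) j); rewrite !mem => /(_ j1A jA idx).
have jz : j - z != 0 by rewrite subr_eq0; apply: contraNneq zA => <-.
move: (j - z) jz (addrAC j (- z) (- 1)) => i i0 <-.
have := subrK 1 i; move: (i - 1) => i' iE; rewrite -{}iE in i0 *.
have [lt|ge] := ltnP (val i').+1 (Zp_trunc k.+1).+2.
  by rewrite /= modn_small modn_small ?addn1 // ltnNge leqnSn.
have {ge} i'E : (val i').+1 = (Zp_trunc k.+1).+2 by apply/eqP; rewrite eqn_leq ge ltn_ord.
by case/eqP: i0; apply: val_inj; rewrite /= addn1 i'E modnn.
Qed.

Definition rdec_decomposition (k : nat) (x : affine_permutation k) (A : seq {set Idx k}) : Prop :=
  equals_product x (flatten (rev (map (@dec_word k) A))).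
Definition rinc_decomposition (k : nat) (x : affine_permutation k) (A : seq {set Idx k}) : Prop :=
  equals_product x (flatten (rev (map (@inc_word k) A))).
Definition ldec_decomposition (k : nat) (x : affine_permutation k) (A : seq {set Idx k}) : Prop :=
  equals_product x (flatten (map (@dec_word k) A)).
Definition linc_decomposition (k : nat) (x : affine_permutation k) (A : seq {set Idx k}) : Prop :=
  equals_product x (flatten (map (@inc_word k) A)).

Definition proper_nonempty (k : nat) (A : seq {set Idx k}) : bool :=
  all (fun S => (S != set0) && (S \proper [set: Idx k])) A.

(* seqlexi nat is seq nat with the lexicographic order. *)
Definition card_seq (k : nat) (A : seq {set Idx k}) : seqlexi nat :=
  map (fun S : {set Idx k} => #|S|) A.

Definition lexmax_decomposition (k : nat) (D : seq {set Idx k} -> Prop)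
    (A : seq {set Idx k}) : Prop :=
  [/\ proper_nonempty A, D A &
      forall B : seq {set Idx k}, proper_nonempty B -> D B ->
        (card_seq B <= card_seq A)%O].

(* The canonical decomposition among those satisfying D.  For the four
   families above a lexicographically maximal decomposition exists and is
   unique, so that neither the default nor the choice matters. *)
Definition canonical (k : nat) (D : seq {set Idx k} -> Prop) : seq {set Idx k} :=
  classical_sets.xget [::] (lexmax_decomposition D).

(* Sequences are indexed from 0: nth set0 A j is the (j+1)-st set. *)
Definition code_minus (k : nat) (A : seq {set Idx k}) : {ffun Idx k -> nat} :=
  [ffun i => #|[set j : 'I_(size A) | i - (j : nat)%:R \in nth set0 A j]|].
Definition code_plus (k : nat) (A : seq {set Idx k}) : {ffun Idx k -> nat} :=
  [ffun i => #|[set j : 'I_(size A) | i + (j : nat)%:R \in nth set0 A j]|].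

Definition RD (k : nat) (x : affine_permutation k) := code_minus (canonical (rdec_decomposition x)).
Definition RI (k : nat) (x : affine_permutation k) := code_plus (canonical (rinc_decomposition x)).
Definition LD (k : nat) (x : affine_permutation k) := code_plus (canonical (ldec_decomposition x)).
Definition LI (k : nat) (x : affine_permutation k) := code_minus (canonical (linc_decomposition x)).

(* Main.v *)
Require Import Defs.
From mathcomp Require Import all_boot all_order all_algebra.
From mathcomp Require Import zify.
From mathcomp Require classical_sets boolp.

(* For an affine permutation f and an integer m let c_f(m) be the number of
   p < m with f p > f m; it depends only on m modulo k + 1, and the sum of c_f
   over a period is the length of f.  If x = g d_A is reduced, then
   c_x(r + 1) > 0 for every r in A; conversely the set of all such r is the
   largest possible A, and removing it gives c_g(r) = max(c_x(r + 1) - 1, 0).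
   Hence the greedy decomposition is the lexicographically maximal one and
   RD(x)_i = c_x(i + 1).  The anti-automorphism s_i |-> s_(-i), which turns x
   into m |-> 1 - x^-1(1 - m), exchanges right and left decreasing
   decompositions and gives LD(x)_i = c_x(x^-1(i)).  So RD(x) and LD(x) list the
   same values in different orders.  Finally RI(x) = LD(x^-1) and
   LI(x) = RD(x^-1). *)

Set Implicit Arguments.
Unset Strict Implicit.
Unset Printing Implicit Defensive.

Import Order.TTheory GRing.Theory Num.Theory.
Local Open Scope ring_scope.

(** * Residues of integers and simple reflections *)

Lemma res_period (k : nat) (m t : int) :
  (m + t * k.+2%:Z)%:~R = m%:~R :> Idx k.+1.
Proof.
have n0 : k.+2%:R = 0 :> Idx k.+1 by apply: pchar_Zp.
by rewrite rmorphD rmorphM /= -pmulrn n0 mulr0 addr0.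
Qed.

(** The index set is [Idx k.+1] rather than [Idx k] because [Idx 0] is Z/2Z, whose modulus is not
    [0.+1]. *)
Lemma res_modz (k : nat) (m : int) :
  (m %% k.+2%:Z)%Z = (m%:~R : Idx k.+1) :> int.
Proof.
rewrite {2}(divz_eq m k.+2%:Z) addrC res_period.
have := modz_ge0 m (isT : k.+2%:Z != 0); have := ltz_pmod m (isT : 0 < k.+2%:Z).
case: (m %% _)%Z => // r; rewrite ltz_nat => r_lt _.
by rewrite -pmulrn val_Zp_nat // modn_small.
Qed.

Lemma res_eqE (k : nat) (m m' : int) : m%:~R = m'%:~R :> Idx k.+1 ->
  exists t, m = m' + t * k.+2%:Z.
Proof.
move=> eq_res; exists ((m %/ k.+2%:Z)%Z - (m' %/ k.+2%:Z)%Z).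
rewrite {1}(divz_eq m k.+2%:Z) {1}(divz_eq m' k.+2%:Z) !res_modz eq_res.
by rewrite mulrBl; lia.
Qed.

Lemma resD1 (k : nat) (m : int) : (m + 1)%:~R = m%:~R + 1 :> Idx k.
Proof. by rewrite rmorphD. Qed.

Lemma resB1 (k : nat) (m : int) : (m - 1)%:~R = m%:~R - 1 :> Idx k.
Proof. by rewrite rmorphB. Qed.

Lemma resK (k : nat) (r : Idx k) : (r : nat)%:Z%:~R = r.
Proof. by rewrite -pmulrn natr_Zp. Qed.

Variant simple_refl_spec (k : nat) (i : Idx k) (m : int) : int -> Prop :=
| SimpleReflUp of m%:~R = i : simple_refl_spec i m (m + 1)
| SimpleReflDown of m%:~R = i + 1 : simple_refl_spec i m (m - 1)
| SimpleReflFix of m%:~R != i & m%:~R != i + 1 : simple_refl_spec i m m.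

Lemma simple_reflP (k : nat) (i : Idx k) (m : int) :
  simple_refl_spec i m (simple_refl i m).
Proof.
rewrite /simple_refl; case: eqP => [?|/eqP ?]; first exact: SimpleReflUp.
by case: eqP => [?|/eqP ?]; [exact: SimpleReflDown | exact: SimpleReflFix].
Qed.

Lemma addr1_neq (k : nat) (i : Idx k) : (i + 1 == i) = false.
Proof. by rewrite -subr_eq0 addrC addKr oner_eq0. Qed.

Lemma simple_refl_up (k : nat) (m : int) : simple_refl (m%:~R : Idx k) m = m + 1.
Proof. by rewrite /simple_refl eqxx. Qed.

Lemma simple_refl_down (k : nat) (m : int) :
  simple_refl (m%:~R : Idx k) (m + 1) = m.
Proof. by rewrite /simple_refl resD1 addr1_neq eqxx addrK. Qed.

Lemma simple_reflK (k : nat) (i : Idx k) : involutive (simple_refl i).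
Proof.
move=> m; case: (simple_reflP i m) => [mi|mi|/negPf mi /negPf mi1].
- by rewrite -mi simple_refl_down.
- have -> : i = (m - 1)%:~R by rewrite resB1 mi addrK.
  by rewrite simple_refl_up subrK.
- by rewrite /simple_refl mi mi1.
Qed.

(** * Words as periodic permutations of the integers *)

Lemma word_fun_cat (k : nat) (u v : seq (Idx k)) (m : int) :
  word_fun (u ++ v) m = word_fun u (word_fun v m).
Proof. by elim: u => //= i u ->. Qed.

Lemma word_funK (k : nat) (w : seq (Idx k)) :
  cancel (word_fun w) (word_fun (rev w)).
Proof.
elim: w => // i w IHw m.
by rewrite rev_cons -cats1 word_fun_cat /= simple_reflK IHw.
Qed.

Lemma word_funVK (k : nat) (w : seq (Idx k)) :
  cancel (word_fun (rev w)) (word_fun w).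
Proof. by move=> m; rewrite -{1}(revK w) word_funK. Qed.

Lemma word_fun_inj (k : nat) (w : seq (Idx k)) : injective (word_fun w).
Proof. exact: can_inj (word_funK w). Qed.

Lemma word_fun_period (k : nat) (w : seq (Idx k.+1)) (m t : int) :
  word_fun w (m + t * k.+2%:Z) = word_fun w m + t * k.+2%:Z.
Proof.
elim: w => //= i w ->; rewrite /simple_refl res_period.
by case: ifP => _; [rewrite addrAC | case: ifP => _ //; rewrite addrAC].
Qed.

(** * Displacements and inversion counts *)

Lemma word_fun_disp (k : nat) (w : seq (Idx k)) (m : int) :
  `|word_fun w m - m| <= (size w)%:Z.
Proof.
elim: w => [|i w IHw] /=; first by rewrite subrr.
by case: simple_reflP => *; lia.
Qed.

(* Only the 2 * size w integers below m are inspected: a word displaces every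
   integer by at most its size, so there are no inversions further away. *)
Definition lehmer (k : nat) (w : seq (Idx k)) (m : int) : nat :=
  count (fun p => word_fun w m < word_fun w p)
        [seq m - d.+1%:Z | d <- iota 0 (2 * size w)].

(** Both ends of an inversion move by at most [size w], so their distance is below [2 * size w] and
    the window misses none. *)
Lemma lehmer_seq (k : nat) (w : seq (Idx k)) (m : int) : exists s : seq int,
  [/\ uniq s, size s = lehmer w m
    & forall p, (p \in s) = (p < m) && (word_fun w m < word_fun w p)].
Proof.
set s := [seq p <- [seq m - d.+1%:Z | d <- iota 0 (2 * size w)]
         | word_fun w m < word_fun w p].
have s_uniq : uniq s.
  by rewrite filter_uniq // map_inj_uniq ?iota_uniq // => a b; lia.
have sE p : (p \in s) = (p < m) && (word_fun w m < word_fun w p).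
  rewrite mem_filter andbC; case: ltP => [wlt|_]; rewrite ?andbF // !andbT.
  apply/mapP/idP => [[d _ ->]|plt]; first by lia.
  exists (absz (m - p - 1)%R); last by lia.
  by rewrite mem_iota; have := word_fun_disp w m; have := word_fun_disp w p; lia.
by exists s; split; rewrite // size_filter.
Qed.

(** Frees the count from the window, and so from the word chosen for the permutation. *)
Lemma lehmerE (k : nat) (w : seq (Idx k)) (m : int) (s : seq int) : uniq s ->
  (forall p, (p \in s) = (p < m) && (word_fun w m < word_fun w p)) ->
  lehmer w m = size s.
Proof.
move=> s_uniq sE; have [t [t_uniq <- tE]] := lehmer_seq w m.
by apply/perm_size/uniq_perm => // p; rewrite sE tE.
Qed.

Lemma eq_lehmer (k : nat) (w w' : seq (Idx k)) :
  word_fun w =1 word_fun w' -> lehmer w =1 lehmer w'.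
Proof.
move=> eq_w m; have [s [s_uniq <- sE]] := lehmer_seq w m.
by apply/esym/lehmerE => // p; rewrite sE !eq_w.
Qed.

Lemma lehmer_period (k : nat) (w : seq (Idx k.+1)) (m m' : int) :
  m%:~R = m'%:~R :> Idx k.+1 -> lehmer w m = lehmer w m'.
Proof.
case/res_eqE => t ->; rewrite /lehmer.
have -> : [seq m' + t * k.+2%:Z - d.+1%:Z | d <- iota 0 (2 * size w)] =
  [seq p + t * k.+2%:Z | p <- [seq m' - d.+1%:Z | d <- iota 0 (2 * size w)]].
  by rewrite -map_comp; apply: eq_map => d /=; rewrite addrAC.
by rewrite count_map; apply: eq_count => p /=; rewrite !word_fun_period ltrD2r.
Qed.

(** * Cyclically decreasing words and removal of a right factor *)

(* The inverse u of d_A: it moves each residue of A up by one, and sends the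
   upper end of a maximal run of A back to the start of that run. *)
Definition upshift (k : nat) (A : {set Idx k}) (u : int -> int) : Prop :=
  forall j : int, if j%:~R \in A then u j = j + 1 else
    [/\ u j <= j, (u j - 1)%:~R \notin A
      & forall p, u j <= p < j -> p%:~R \in A].

(** Outside A the value is the start of the run ending just below j: of two candidates, the
    predecessor of the larger one would have to lie in A. *)
Lemma upshift_unique (k : nat) (A : {set Idx k}) (u v : int -> int) :
  upshift A u -> upshift A v -> u =1 v.
Proof.
move=> uA vA j; move: (uA j) (vA j); case: ifP => [_ -> -> //|_].
move=> [uj uj1 ujA] [vj vj1 vjA]; apply/eqP; rewrite eq_le.
apply/andP; split; rewrite leNgt.
  by apply: contraNN uj1 => lt; apply: vjA; lia.
by apply: contraNN vj1 => lt; apply: ujA; lia.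
Qed.

(** Characterises the words of the d_A without the missing index chosen by [dec_word]; the condition
    passes to suffixes, as inductions on words require. *)
Definition cyc_decreasing (k : nat) (d : seq (Idx k)) : bool :=
  pairwise (fun i j => (j != i) && (j != i + 1)) d.

(** Induction on the word. Neither b nor b + 1 occurs in d, so s_b sends b to b + 1, a fixed point
    of [rev d], and sends b + 1 to b, hence on to the start of the run of d ending below b, which b
    prolongs. *)
Lemma upshift_rev (k : nat) (d : seq (Idx k)) : cyc_decreasing d ->
  upshift [set i in d] (word_fun (rev d)).
Proof.
elim: d => [_ j|b d IHd]; first by rewrite inE /=; split=> [||p]; rewrite ?inE //; lia.
rewrite /cyc_decreasing /= => /andP[/allP bd /IHd{}IHd] j.
have bNd : b \notin d by apply/negP=> /bd; rewrite eqxx.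
have b1Nd : b + 1 \notin d by apply/negP=> /bd; rewrite eqxx andbF.
rewrite rev_cons -cats1 word_fun_cat /= !inE.
case: simple_reflP => [jb|jb|/negPf jb /negPf jb1].
- rewrite jb eqxx /=; have := IHd (j + 1); rewrite inE resD1 jb (negPf b1Nd).
  case=> uj _ ujd; apply/eqP; rewrite eq_le uj leNgt.
  apply: contraNN bNd => lt; have := ujd j; rewrite jb inE; apply.
  by lia.
- rewrite jb addr1_neq (negPf b1Nd) /=.
  have j1b : (j - 1)%:~R = b by rewrite resB1 jb addrK.
  have := IHd (j - 1); rewrite inE j1b (negPf bNd) => -[uj uj1 ujd].
  split; first by lia.
    rewrite negb_or; move: uj1; rewrite inE => ->; rewrite andbT.
    (* Otherwise the run starts at residue b + 1. An empty run starts at [j - 1], of residue b; a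
       nonempty one puts b + 1 in d. *)
    apply: contraNN b1Nd => /eqP uj1.
    have [eq_uj|ne_uj] := eqVneq (word_fun (rev d) (j - 1)) (j - 1).
      move: uj1; rewrite eq_uj resB1 j1b => /eqP.
      by rewrite subr_eq eq_sym addr1_neq.
    have := ujd (word_fun (rev d) (j - 1)); rewrite inE.
    rewrite -[X in X%:~R \in d](subrK 1) resD1 uj1; apply.
    by lia.
  move=> p p_in; rewrite !inE; have [->|ne_p] := eqVneq p (j - 1).
    by rewrite j1b eqxx.
  have := ujd p; rewrite inE => ->; first exact: orbT.
  by lia.
- rewrite jb /=; have := IHd j; rewrite inE; case: ifP => // jd [uj uj1 ujd].
  split=> //; last by move=> p /ujd; rewrite !inE => ->; rewrite orbT.
  rewrite negb_or; move: uj1; rewrite inE => ->; rewrite andbT.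
  apply: contraNN b1Nd => /eqP uj1.
  have uj_res : (word_fun (rev d) j)%:~R = b + 1.
    by rewrite -[X in X%:~R](subrK 1) resD1 uj1.
  have [eq_uj|ne_uj] := eqVneq (word_fun (rev d) j) j.
    by move: jb1; rewrite -eq_uj uj_res eqxx.
  by have := ujd (word_fun (rev d) j); rewrite inE uj_res; apply; lia.
Qed.

Lemma next_notin (k : nat) (A : {set Idx k.+1}) (j : int) :
  A \proper [set: Idx k.+1] -> exists e : int,
    [/\ j < e, e%:~R \notin A & forall p, j < p < e -> p%:~R \in A].
Proof.
case/properP=> _ [r _ rA].
have ex_e : exists i : nat, (j + 1 + i%:Z)%:~R \notin A.
  (* Adding [|j| + 1] periods to the missing residue r gives an integer above j. *)
  exists (absz ((r : nat)%:Z + (`|j| + 1) * k.+2%:Z - j - 1)%R).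
  have -> : j + 1 + absz ((r : nat)%:Z + (`|j| + 1) * k.+2%:Z - j - 1)%R =
            (r : nat)%:Z + (`|j| + 1) * k.+2%:Z by nia.
  by rewrite res_period resK.
exists (j + 1 + (ex_minn ex_e)%:Z); case: ex_minnP => i iA i_min.
split=> //; first by lia.
move=> p jpi; apply/negPn/negP => pA.
have := i_min (absz (p - j - 1)%R).
have -> : j + 1 + absz (p - j - 1)%R = p by lia.
by move=> /(_ pA); lia.
Qed.

(** Inversions are transported along q = u p. The map u reverses only the pairs formed by a member
    of A and the first integer e after its run. Since w is largest on [u e, e] at u e, each member
    gains exactly one inversion, and nothing else changes. *)
Lemma lehmer_upshift (k : nat) (w d : seq (Idx k.+1)) (A : {set Idx k.+1}) :
  A \proper [set: Idx k.+1] -> upshift A (word_fun (rev d)) ->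
  (forall j q, j%:~R \notin A -> word_fun (rev d) j < q <= j ->
     word_fun w q < word_fun w (word_fun (rev d) j)) ->
  forall j, lehmer w (word_fun (rev d) j) =
    (lehmer (w ++ rev d) j + (j%:~R \in A))%N.
Proof.
move=> Apr uA; set u := word_fun (rev d) in uA * => wH j.
have uI : injective u by apply: word_fun_inj.
have [s [s_uniq <- sE]] := lehmer_seq (w ++ rev d) j.
have {}sE p : (p \in s) = (p < j) && (word_fun w (u j) < word_fun w (u p)).
  by rewrite sE !word_fun_cat.
have uK q : exists p, q = u p by exists (word_fun d q); rewrite /u word_funK.
have [jA|jA] := boolP (j%:~R \in A); last first.
  rewrite addn0 -(size_map u); apply: lehmerE; first by rewrite map_inj_uniq.
  move=> q; have [p ->] := uK q; rewrite mem_map // sE.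
  have [lt_f|_] := ltP (word_fun w (u j)) (word_fun w (u p)); rewrite ?andbF // !andbT.
  have := uA j; rewrite (negPf jA) => -[uj uj1 ujA].
  have ne_uj : u p != u j by apply: contraTneq lt_f => ->; rewrite ltxx.
  have ne_j : p != j by apply: contraNneq ne_uj => ->.
  have := uA p; case: ifP => [_ up|pA [up up1 upA]]; apply/idP/idP => lt_p; try by lia.
  - rewrite ltNge; apply: contraTN lt_f => le_u; rewrite -leNgt ltW // wH //; lia.
  - rewrite ltNge; apply: contraTN lt_f => le_u; rewrite -leNgt ltW // wH //; lia.
  - case: (ltP p j) => // le_j; move: uj1; rewrite upA //; lia.
(* The extra inversion is at [u e]: here [j < e], yet [u e < u j]. *)
have [e [je eA eP]] := next_notin j Apr.
have := uA e; rewrite (negPf eA) => -[ue ue1 ueA].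
have uej : u e <= j.
  rewrite leNgt; apply: contraNN ue1 => lt_ue.
  have [->//|ne] := eqVneq (u e - 1) j.
  by apply: eP; lia.
have uj : u j = j + 1 by have := uA j; rewrite jA.
have lt_e : word_fun w (u j) < word_fun w (u e) by apply: wH => //; lia.
have -> : (size s + true)%N = size (u e :: map u s) by rewrite /= size_map addn1.
apply: lehmerE => [/=|q].
  rewrite map_inj_uniq // s_uniq andbT mem_map // sE.
  by apply/negP => /andP[]; lia.
have [p ->] := uK q; rewrite inE mem_map // sE (inj_eq uI).
have [->|ne_e] /= := eqVneq p e; first by rewrite lt_e andbT; lia.
congr (_ && _); have := uA p; case: ifP => [_ ->|pA [up up1 upA]]; first by lia.
have [lt_p|] := ltP p j; first by lia.
have [->|ne_j] := eqVneq p j; first by lia.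
move=> le_j; have lt_j : j < p by lia.
have [lt_pe|le_ep] := ltP p e; first by rewrite eP ?lt_j in pA.
have lt_ep : e < p by lia.
apply/esym/negbTE; rewrite -leNgt; case: (leP (u j) (u p)) => // lt_up.
by move: eA; rewrite upA //; lia.
Qed.

(** * The code on residues and its sum, the length *)

Definition code (k : nat) (w : seq (Idx k)) (r : Idx k) : nat :=
  lehmer w (r : nat)%:Z.

Lemma codeE (k : nat) (w : seq (Idx k.+1)) (m : int) : code w m%:~R = lehmer w m.
Proof. by apply: lehmer_period; rewrite resK. Qed.

Definition len (k : nat) (w : seq (Idx k)) : nat := (\sum_r code w r)%N.

Lemma eq_code (k : nat) (w w' : seq (Idx k)) :
  word_fun w =1 word_fun w' -> code w =1 code w'.
Proof. by move=> eq_w r; apply: eq_lehmer. Qed.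

Lemma eq_len (k : nat) (w w' : seq (Idx k)) :
  word_fun w =1 word_fun w' -> len w = len w'.
Proof. by move=> eq_w; apply: eq_bigr => r _; apply: eq_code. Qed.

Definition res_fun (k : nat) (w : seq (Idx k)) (r : Idx k) : Idx k :=
  (word_fun w (r : nat)%:Z)%:~R.

Lemma res_funE (k : nat) (w : seq (Idx k.+1)) (m : int) :
  res_fun w m%:~R = (word_fun w m)%:~R.
Proof.
have [|t {2}->] := @res_eqE k m ((m%:~R : Idx k.+1) : nat); first by rewrite resK.
by rewrite word_fun_period res_period.
Qed.

Lemma res_funK (k : nat) (w : seq (Idx k.+1)) :
  cancel (res_fun w) (res_fun (rev w)).
Proof. by move=> r; rewrite {2}/res_fun res_funE word_funK resK. Qed.

Lemma res_fun_inj (k : nat) (w : seq (Idx k.+1)) : injective (res_fun w).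
Proof. exact: can_inj (res_funK w). Qed.

Lemma len_upshift (k : nat) (w d : seq (Idx k.+1)) (A : {set Idx k.+1}) :
  A \proper [set: Idx k.+1] -> upshift A (word_fun (rev d)) ->
  (forall j q, j%:~R \notin A -> word_fun (rev d) j < q <= j ->
     word_fun w q < word_fun w (word_fun (rev d) j)) ->
  len w = (len (w ++ rev d) + #|A|)%N.
Proof.
move=> Apr uA wH; rewrite /len (reindex_inj (@res_fun_inj _ (rev d))) /=.
have -> : #|A| = (\sum_r (r \in A))%N by rewrite -sum1_card big_mkcond.
rewrite -big_split; apply: eq_bigr => r _.
by rewrite codeE (lehmer_upshift Apr uA wH) resK.
Qed.

(** The case of a singleton in [len_upshift]: every run is one translate of m, so the condition on
    runs is the descent itself. *)
Lemma len_descent (k : nat) (w : seq (Idx k.+1)) (m : int) :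
  word_fun w (m + 1) < word_fun w m ->
  len w = (len (w ++ [:: m%:~R])).+1.
Proof.
move=> desc; rewrite -[RHS]addn1 -[X in (_ + X)%N](cards1 (m%:~R : Idx k.+1)).
apply: (@len_upshift _ _ [:: m%:~R]).
- apply/properP; split; first exact: subsetT.
  by exists (m%:~R + 1); rewrite ?inE // addr1_neq.
- have := @upshift_rev _ [:: m%:~R : Idx k.+1] isT.
  by congr upshift; apply/setP => r; rewrite !inE.
move=> j q _ /=; case: simple_reflP => [||]; rewrite -?resD1; try lia.
case/res_eqE => t -> /= lt_q.
have -> : q = m + 1 + t * k.+2%:Z by lia.
have -> : m + 1 + t * k.+2%:Z - 1 = m + t * k.+2%:Z by lia.
by rewrite !word_fun_period ltrD2r.
Qed.

Lemma len_ascent (k : nat) (w : seq (Idx k.+1)) (m : int) :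
  word_fun w m < word_fun w (m + 1) ->
  len (w ++ [:: m%:~R]) = (len w).+1.
Proof.
move=> asc; rewrite (@len_descent _ _ m).
  congr _.+1; apply: eq_len => p; rewrite !word_fun_cat /=.
  by rewrite simple_reflK.
by rewrite !word_fun_cat /= simple_refl_up simple_refl_down.
Qed.

(** Each appended letter changes the length by one, up at an ascent and down at a descent. *)
Lemma len_cat (k : nat) (w v : seq (Idx k.+1)) :
  (len (w ++ v) <= len w + size v)%N.
Proof.
elim/last_ind: v => [|v i IHv]; first by rewrite cats0 addn0.
rewrite size_rcons -cats1 catA -(resK i).
have [lt|lt|/word_fun_inj] :=
  ltgtP (word_fun (w ++ v) (i : nat)%:Z) (word_fun (w ++ v) ((i : nat)%:Z + 1)).
- by rewrite len_ascent // addnS.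
- by move: IHv; rewrite (len_descent lt) addnS => /ltnW/leqW.
- by lia.
Qed.

Lemma len_nil (k : nat) : len ([::] : seq (Idx k)) = 0%N.
Proof. by apply: big1. Qed.

Lemma len_size (k : nat) (w : seq (Idx k.+1)) : (len w <= size w)%N.
Proof. by have := len_cat [::] w; rewrite len_nil. Qed.

(** * The largest cyclically decreasing right factor *)

Lemma lehmer_gt0P (k : nat) (w : seq (Idx k)) (m : int) :
  reflect (exists2 p, p < m & word_fun w m < word_fun w p) (0 < lehmer w m)%N.
Proof.
apply: (iffP idP); have [s [_ <- sE]] := lehmer_seq w m; rewrite -has_predT.
  by case/hasP => p; rewrite sE => /andP[pm lt] _; exists p.
by case=> p pm lt; apply/hasP; exists p; rewrite // sE pm.
Qed.

(* max_right w is the largest set A such that d_A is a right factor of w. *)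
Definition max_right (k : nat) (w : seq (Idx k)) : {set Idx k} :=
  [set r : Idx k | (0 < code w (r + 1)%R)%N].

Lemma max_rightP (k : nat) (w : seq (Idx k.+1)) (m : int) :
  reflect (exists2 p, p <= m & word_fun w (m + 1) < word_fun w p)
    (m%:~R \in max_right w).
Proof.
rewrite inE -resD1 codeE.
by apply: (iffP (lehmer_gt0P _ _)) => -[p pm lt]; exists p => //; lia.
Qed.

(** If r maximises the displacement, every p < r has a value below that of r; so r has no inversion
    and [r - 1] is missing. *)
Lemma max_right_proper (k : nat) (w : seq (Idx k.+1)) :
  max_right w \proper [set: Idx k.+1].
Proof.
pose disp (r : Idx k.+1) := word_fun w (r : nat)%:Z - (r : nat)%:Z.
have dispE m : disp m%:~R = word_fun w m - m.
  have [|t {2 3}->] := @res_eqE k m ((m%:~R : Idx k.+1) : nat); first by rewrite resK.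
  by rewrite word_fun_period /disp; lia.
apply/properP; split; first exact: subsetT.
case: (@arg_maxP _ _ _ (0 : Idx k.+1) xpredT disp isT) => r _ r_max.
exists (r - 1); rewrite // -(resK r) -resB1; apply/max_rightP => -[p p_lt lt_p].
have := r_max p%:~R isT; rewrite /= -{1}(resK r) !dispE.
by move: p_lt lt_p; rewrite subrK; lia.
Qed.

(** As [u j - 1] is not in the set, no earlier value exceeds that at [u j]. Every later q up to j
    has a larger value to its left, and strong induction on [q - u j] leads back to [u j] or
    before. *)
Lemma max_right_upshift (k : nat) (w : seq (Idx k.+1)) (u : int -> int) :
  upshift (max_right w) u ->
  forall j q, j%:~R \notin max_right w -> u j < q <= j ->
    word_fun w q < word_fun w (u j).
Proof.
move=> uA j q jA; have := uA j; rewrite (negPf jA) => -[uj uj1 ujA].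
have uj_max p : p < u j -> word_fun w p <= word_fun w (u j).
  move=> lt_p; rewrite leNgt; apply: contraNN uj1 => lt_w.
  by apply/max_rightP; exists p; rewrite ?subrK //; lia.
have [n] := ubnP (absz (q - u j)%R); elim: n q => // n IHn q lt_n q_in.
have /ujA/max_rightP[] : u j <= q - 1 < j by lia.
rewrite subrK => p le_p lt_w.
have [lt_p|lt_p|eq_p] := ltgtP p (u j).
- exact: lt_le_trans lt_w (uj_max p lt_p).
- by apply: lt_trans lt_w (IHn p _ _); lia.
- by rewrite -eq_p.
Qed.

(** For r in the set, u raises r by one and one inversion is lost. Otherwise both sides vanish,
    since neither r nor [u r - 1] is in the set. *)
Lemma code_max_right (k : nat) (w d : seq (Idx k.+1)) (r : Idx k.+1) :
  upshift (max_right w) (word_fun (rev d)) ->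
  code (w ++ rev d) r = (code w (r + 1)).-1.
Proof.
move=> uA; rewrite -(resK r) -resD1; set m := (r : nat)%:Z.
have := lehmer_upshift (max_right_proper w) uA (max_right_upshift uA) m.
rewrite !codeE; have := uA m; case: ifP => [_ ->|mA [_ um1 _]]; first by lia.
have : lehmer w (m + 1) = 0%N.
  by move: mA; rewrite inE -resD1 codeE; lia.
move: um1; rewrite inE -resD1 subrK codeE; lia.
Qed.

Lemma right_factor_sub (k : nat) (w d : seq (Idx k.+1)) : cyc_decreasing d ->
  size (w ++ d) = len (w ++ d) -> {subset d <= max_right (w ++ d)}.
Proof.
elim: d w => // b d IHd w; rewrite /cyc_decreasing /= => /andP[/allP bd d_dec] red.
have bNd : b \notin d by apply/negP=> /bd; rewrite eqxx.
have b1Nd : b + 1 \notin d by apply/negP=> /bd; rewrite eqxx andbF.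
have uA := upshift_rev d_dec.
move=> j; rewrite inE => /predU1P[->{j}|jd]; last first.
  by move: red; rewrite -cat_rcons => red; apply: IHd.
move: bNd b1Nd red bd; rewrite -(resK b) -resD1; set m := (b : nat)%:Z.
move=> bNd b1Nd red _.
(* At a descent, w s_b would be shorter than w and the whole word could not be reduced. *)
have asc : word_fun w m < word_fun w (m + 1).
  case: ltgtP => // [desc|/word_fun_inj]; last by lia.
  have := len_cat (w ++ [:: m%:~R]) d; have := len_descent desc.
  move: red; rewrite -catA /= size_cat /=; have := len_size w; lia.
have um1 : word_fun (rev d) (m + 1) = m + 1.
  have := uA (m + 1); rewrite inE (negPf b1Nd) => -[um _ umd].
  apply/eqP; rewrite eq_le um leNgt /=; apply: contraNN bNd => lt_um.
  by have := umd m; rewrite inE; apply; lia.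
(* The whole word takes the value w(m + 1) at this p and w(m) at m + 1, because d fixes m + 1 and
   sends p to m. *)
apply/max_rightP; exists (word_fun (rev d) m).
  by have := uA m; rewrite inE (negPf bNd) => -[].
rewrite !word_fun_cat /= -{1}um1 word_funVK word_funVK.
by rewrite simple_refl_up simple_refl_down.
Qed.

(** * Length zero forces the identity *)

Lemma sum_word_fun_disp (k : nat) (w : seq (Idx k.+1)) :
  \sum_(r : Idx k.+1) (word_fun w (r : nat)%:Z - (r : nat)%:Z) = 0.
Proof.
elim: w => [|i w IHw]; first by apply: big1 => r _; rewrite subrr.
(* The displacement by s_i sums to zero over residues, and w merely permutes the residues at which
   it is evaluated. *)
pose d (r : Idx k.+1) : int := (r == i)%:Z - (r == i + 1)%:Z.
have reflE m : simple_refl i m = m + d m%:~R.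
  rewrite /d; case: simple_reflP => [->|->|/negPf-> /negPf->]; last by rewrite addr0.
    by rewrite eqxx eq_sym addr1_neq.
  by rewrite eqxx addr1_neq.
transitivity (\sum_(r : Idx k.+1) (word_fun w (r : nat)%:Z - (r : nat)%:Z) +
    \sum_r d (res_fun w r)).
  by rewrite -big_split /=; apply: eq_bigr => r _; rewrite reflE -res_funE resK addrAC.
have <- := reindex_inj (@res_fun_inj _ w) (P := xpredT) (F := d).
rewrite IHw add0r sumrB.
have sum1 (j : Idx k.+1) : \sum_r (r == j)%:Z = 1.
  by rewrite (bigD1 j) //= eqxx big1 // => r /negPf->.
by rewrite !sum1 subrr.
Qed.

(** Without inversions w is increasing; being onto, it is a translation, and zero total displacement
    makes the translation trivial. *)
Lemma len0_id (k : nat) (w : seq (Idx k.+1)) : len w = 0%N -> word_fun w =1 id.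
Proof.
move=> len_w; have noinv p m : p < m -> word_fun w p <= word_fun w m.
  move=> lt_p; rewrite leNgt; apply/negP => lt_w.
  have /lehmer_gt0P : exists2 p, p < m & word_fun w m < word_fun w p by exists p.
  by rewrite -codeE; move/eqP: len_w; rewrite sum_nat_eq0 => /forallP/(_ m%:~R)/eqP->.
have step m : word_fun w (m + 1) = word_fun w m + 1.
  have lt_m : word_fun w m < word_fun w (m + 1).
    rewrite lt_neqAle noinv ?ltrDl // andbT.
    by apply/eqP => /word_fun_inj; lia.
  (* The preimage p of w(m) + 1 can only be m + 1, by monotonicity. *)
  have /esym := word_funVK w (word_fun w m + 1).
  set p := word_fun (rev w) _ => Ep.
  have [lt_p|lt_p|eq_p] := ltgtP p (m + 1); last by rewrite Ep eq_p.
    have [eq_p|ne_p] := eqVneq p m; first by move: Ep; rewrite eq_p; lia.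
    have /noinv : p < m by lia.
    by lia.
  by have /noinv := lt_p; lia.
have disp (i : nat) : word_fun w i%:Z - i%:Z = word_fun w 0.
  by elim: i => [|i IHi]; [rewrite subr0 | rewrite intS (addrC 1) step; lia].
have := sum_word_fun_disp w; under eq_bigr do rewrite disp.
rewrite sumr_const card_ord => /eqP; rewrite mulrn_eq0 /= => /eqP f0 m.
have [|t ->] := @res_eqE k m ((m%:~R : Idx k.+1) : nat); first by rewrite resK.
by rewrite word_fun_period; have := disp (m%:~R : Idx k.+1); lia.
Qed.

(** * Greedy right decreasing decompositions *)

Lemma cyc_decreasing_dec_word (k : nat) (A : {set Idx k}) :
  A \proper [set: Idx k] -> cyc_decreasing (dec_word A).
Proof.
move=> Apr; have dA := dec_word_perm Apr.
have d_uniq : uniq (dec_word A) by rewrite (perm_uniq dA) enum_uniq.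
apply/(pairwiseP 0) => a b /= a_lt b_lt ab.
have mem i : (i < size (dec_word A))%N -> nth 0 (dec_word A) i \in A.
  by move=> i_lt; rewrite -mem_enum -(perm_mem dA) mem_nth.
rewrite nth_uniq // neq_ltn ab orbT /=; apply/eqP => eq_b.
have := @dec_word_order _ A (nth 0 (dec_word A) b) Apr (mem _ b_lt).
by rewrite eq_b addrK -eq_b mem // !index_uniq // => /(_ isT); lia.
Qed.

Lemma set_dec_word (k : nat) (A : {set Idx k}) :
  A \proper [set: Idx k] -> [set i in dec_word A] = A.
Proof.
by move=> Apr; apply/setP => i; rewrite inE (perm_mem (dec_word_perm Apr)) mem_enum.
Qed.

Lemma size_dec_word (k : nat) (A : {set Idx k}) :
  A \proper [set: Idx k] -> size (dec_word A) = #|A|.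
Proof. by move=> Apr; rewrite (perm_size (dec_word_perm Apr)) cardE. Qed.

Lemma upshift_dec_word (k : nat) (A : {set Idx k}) :
  A \proper [set: Idx k] -> upshift A (word_fun (rev (dec_word A))).
Proof.
move=> Apr; rewrite -{1}(set_dec_word Apr).
exact: upshift_rev (cyc_decreasing_dec_word Apr).
Qed.

Definition rdec_word (k : nat) (A : seq {set Idx k}) : seq (Idx k) :=
  flatten (rev (map (@dec_word k) A)).

Lemma rdec_word_cons (k : nat) (S : {set Idx k}) (A : seq {set Idx k}) :
  rdec_word (S :: A) = rdec_word A ++ dec_word S.
Proof. by rewrite /rdec_word /= rev_cons flatten_rcons. Qed.

Lemma code_minus_cons (k : nat) (S : {set Idx k}) (A : seq {set Idx k}) (i : Idx k) :
  code_minus (S :: A) i = ((i \in S) + code_minus A (i - 1)%R)%N.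
Proof.
rewrite !ffunE -!sum1_card big_mkcond big_ord_recl /= inE subr0; congr (_ + _)%N.
rewrite [RHS]big_mkcond; apply: eq_bigr => j _; rewrite !inE /=.
by rewrite /bump add1n -natr1 opprD addrA addrAC.
Qed.

(** The size is compared with [len w] and not [size w], so w may be any word of the permutation,
    reduced or not. *)
Definition reduced_for (k : nat) (w v : seq (Idx k)) : Prop :=
  word_fun v =1 word_fun w /\ size v = len w.

(** Strong induction on the length, splitting off [max_right w]. The last clause yields maximality
    and uniqueness together. *)
Lemma greedy_decomposition (k : nat) (w : seq (Idx k.+1)) :
  exists A : seq {set Idx k.+1},
  [/\ proper_nonempty A, reduced_for w (rdec_word A),
      forall i, code_minus A i = code w (i + 1)
    & forall B, proper_nonempty B -> reduced_for w (rdec_word B) ->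
        (card_seq B < card_seq A)%O \/ B = A].
Proof.
have [n] := ubnP (len w); elim: n w => // n IHn w lt_n.
have code0 : max_right w = set0 -> len w = 0%N.
  move=> M0; apply: big1 => r _; apply/eqP; rewrite -leqn0 leqNgt.
  by have := in_set0 (r - 1); rewrite -M0 inE subrK => ->.
have [len0|len_gt0] := posnP (len w).
  have w_id := len0_id len0; exists [::]; split=> //.
  - by split; rewrite ?len0 // => m; rewrite w_id.
  - move=> i; rewrite ffunE.
    have -> : code w (i + 1) = 0%N.
      by move/eqP: len0; rewrite sum_nat_eq0 => /forallP/(_ (i + 1))/eqP.
    by apply: eq_card0 => -[].
  - case=> [|S B] /=; first by right.
    case/andP=> /andP[S0 Spr] _ [_].
    rewrite rdec_word_cons size_cat size_dec_word // len0 => /eqP.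
    by rewrite addn_eq0 cards_eq0 (negPf S0) andbF.
set M := max_right w; have Mpr : M \proper [set: Idx k.+1] := max_right_proper w.
have M0 : M != set0 by apply: contraTneq len_gt0 => /code0->.
have uM := upshift_dec_word Mpr; set d := dec_word M in uM.
have len_g : len w = (len (w ++ rev d) + #|M|)%N.
  exact: len_upshift Mpr uM (max_right_upshift uM).
have M_gt0 : (0 < #|M|)%N by rewrite card_gt0.
(* The unreduced word [w ++ rev d] stands for the permutation with d_M removed on the right. *)
have [|A [Apr [A_fun A_size] A_code A_max]] := IHn (w ++ rev d); first by lia.
exists (M :: A); split.
- by rewrite /= M0 Mpr.
- split; last by rewrite rdec_word_cons size_cat A_size size_dec_word // len_g.
  by move=> m; rewrite rdec_word_cons word_fun_cat A_fun word_fun_cat word_funK.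
- move=> i; rewrite code_minus_cons A_code subrK (code_max_right _ uM) inE.
  by case: (code w (i + 1)).
case=> [|S B] /=; first by left; rewrite /card_seq /= ltxi0s.
case/andP=> /andP[S0 Spr] Bpr [SB_fun SB_size].
have eq_M : max_right (rdec_word (S :: B)) = M.
  by apply/setP => r; rewrite !inE (eq_code SB_fun).
move: SB_fun SB_size eq_M; rewrite rdec_word_cons => SB_fun SB_size eq_M.
have SM : S \subset M.
  apply/subsetP => i; rewrite -{1}(set_dec_word Spr) inE => iS.
  rewrite -eq_M; apply: right_factor_sub iS; first exact: cyc_decreasing_dec_word.
  by rewrite SB_size; apply/esym/eq_len.
have leSM := subset_leq_card SM.
(* A smaller first set already loses at the head; equal cardinality forces S = M, and the tails are
   compared by induction. *)
have [ltSM|leMS] := ltnP #|S| #|M|.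
  by left; rewrite /card_seq /= neqhead_ltxiE ?ltEnat //= neq_ltn ltSM.
have eqSM : S = M by apply/eqP; rewrite eqEcard SM.
move: SB_fun SB_size; rewrite eqSM -/d => SB_fun SB_size.
have [|lt_BA|->] := A_max B Bpr; last by right.
- split=> [m|]; first by rewrite word_fun_cat -SB_fun word_fun_cat word_funVK.
  by move: SB_size; rewrite size_cat size_dec_word // len_g => /addIn.
- by left; rewrite /card_seq /= eqhead_ltxiE.
Qed.

(** The strict alternative excludes a second maximal decomposition, so the choice made by [xget] is
    forced. *)
Lemma canonicalE (k : nat) (D : seq {set Idx k} -> Prop) (A : seq {set Idx k}) :
  proper_nonempty A -> D A ->
  (forall B, proper_nonempty B -> D B -> (card_seq B < card_seq A)%O \/ B = A) ->
  canonical D = A.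
Proof.
move=> Apr DA A_max; apply: classical_sets.xget_unique => [|B [Bpr DB B_max]].
  by split=> // B Bpr DB; have [/ltW|->] := A_max B Bpr DB.
have [lt_BA|//] := A_max B Bpr DB.
by have := B_max A Apr DA; rewrite leNgt lt_BA.
Qed.

Lemma canonical_void (k : nat) (D : seq {set Idx k} -> Prop) :
  (forall B, ~ D B) -> canonical D = [::].
Proof. by move=> D0; apply: classical_sets.xgetPN => B [_ /D0]. Qed.

(** * Exchange of right and left decompositions *)

(* The anti-automorphism s_i |-> s_(-i). *)
Definition opp_word (k : nat) (w : seq (Idx k)) : seq (Idx k) :=
  map -%R (rev w).

Lemma opp_word_cat (k : nat) (u v : seq (Idx k)) :
  opp_word (u ++ v) = opp_word v ++ opp_word u.
Proof. by rewrite /opp_word rev_cat map_cat. Qed.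

Lemma size_opp_word (k : nat) (w : seq (Idx k)) : size (opp_word w) = size w.
Proof. by rewrite size_map size_rev. Qed.

(** The map m |-> 1 - m carries the residues i and i + 1 to 1 - i and - i, the two exchanged by
    s_(-i). *)
Lemma simple_reflN (k : nat) (i : Idx k) (m : int) :
  simple_refl (- i) m = 1 - simple_refl i (1 - m).
Proof.
have -> : simple_refl i (1 - m) = 1 - simple_refl (- i) m; last by lia.
have res1m : (1 - m)%:~R = 1 - m%:~R :> Idx k by rewrite rmorphB.
case: (simple_reflP (- i) m) => [mi|mi|/negPf mi /negPf mi1].
- have -> : i = (- m)%:~R by rewrite rmorphN /= mi opprK.
  by rewrite (addrC 1) simple_refl_down; lia.
- have -> : i = (1 - m)%:~R by rewrite res1m mi opprD opprK addrCA subrr addr0.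
  by rewrite simple_refl_up; lia.
rewrite /simple_refl res1m.
have -> : (1 - m%:~R == i) = (m%:~R == - i + 1).
  by rewrite [in RHS]eq_sym (addrC (- i)) !subr_eq addrC.
by rewrite mi1 (addrC i) (inj_eq (addrI 1)) eqr_oppLR mi.
Qed.

Lemma word_fun_opp (k : nat) (w : seq (Idx k)) (m : int) :
  word_fun (opp_word w) m = 1 - word_fun (rev w) (1 - m).
Proof.
rewrite /opp_word; elim: (rev w) m => [|i v IHv] m /=; first by lia.
by rewrite simple_reflN IHv; congr (1 - simple_refl _ _); lia.
Qed.

Lemma eq_word_fun_rev (k : nat) (v w : seq (Idx k)) :
  word_fun v =1 word_fun w -> word_fun (rev v) =1 word_fun (rev w).
Proof.
by move=> eq_vw m; apply: (@word_fun_inj _ w); rewrite -eq_vw !word_funVK.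
Qed.

Lemma eq_word_fun_opp (k : nat) (v w : seq (Idx k)) :
  word_fun v =1 word_fun w -> word_fun (opp_word v) =1 word_fun (opp_word w).
Proof. by move=> eq_vw m; rewrite !word_fun_opp (eq_word_fun_rev eq_vw). Qed.

Lemma opp_wordK (k : nat) : involutive (@opp_word k).
Proof.
by move=> w; rewrite /opp_word -map_rev revK -map_comp map_id_in // => i _ /=; rewrite opprK.
Qed.

(** Passing to the inverse trades positions for values, and m |-> 1 - m restores the order: q |-> 1
    - w(q) matches the inversions. *)
Lemma lehmer_opp (k : nat) (w : seq (Idx k)) (m : int) :
  lehmer (opp_word w) m = lehmer w (word_fun (rev w) (1 - m)).
Proof.
have [s [s_uniq <- sE]] := lehmer_seq w (word_fun (rev w) (1 - m)).
rewrite -(size_map (fun q => 1 - word_fun w q)); apply: lehmerE.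
  by rewrite map_inj_uniq // => p q; rewrite /= => eq_pq; apply: (@word_fun_inj _ w); lia.
move=> p; have -> : p = 1 - word_fun w (word_fun (rev w) (1 - p)).
  by rewrite word_funVK; lia.
set q := word_fun (rev w) _; rewrite (mem_map (f := fun q => 1 - word_fun w q)).
  rewrite sE !word_fun_opp word_funVK subKr word_funK andbC.
  by congr andb; lia.
by move=> p' q' /= eq_pq; apply: (@word_fun_inj _ w); lia.
Qed.

Lemma code_opp (k : nat) (w : seq (Idx k.+1)) (r : Idx k.+1) :
  code (opp_word w) (1 - r) = code w (res_fun (rev w) r).
Proof.
have -> : 1 - r = (1 - (r : nat)%:Z)%:~R :> Idx k.+1 by rewrite rmorphB /= resK.
by rewrite !codeE lehmer_opp subKr.
Qed.

Lemma len_opp (k : nat) (w : seq (Idx k.+1)) : len (opp_word w) = len w.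
Proof.
rewrite /len (reindex_inj (subrI (1 : Idx k.+1))) /=.
rewrite [RHS](reindex_inj (@res_fun_inj _ (rev w))) /=.
by apply: eq_bigr => r _; rewrite code_opp.
Qed.

Lemma reduced_for_opp (k : nat) (w v : seq (Idx k.+1)) :
  reduced_for w v <-> reduced_for (opp_word w) (opp_word v).
Proof.
rewrite /reduced_for size_opp_word len_opp.
split=> -[eq_vw ->]; split=> //; first exact: eq_word_fun_opp.
by rewrite -[v]opp_wordK -[w]opp_wordK; apply: eq_word_fun_opp.
Qed.

Definition oppset (k : nat) (A : {set Idx k}) : {set Idx k} := -%R @: A.

Lemma in_oppset (k : nat) (A : {set Idx k}) (i : Idx k) :
  (i \in oppset A) = (- i \in A).
Proof. by rewrite -{1}[i]opprK mem_imset //; apply: oppr_inj. Qed.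

Lemma oppsetK (k : nat) : involutive (@oppset k).
Proof. by move=> A; apply/setP => i; rewrite !in_oppset opprK. Qed.

Lemma card_oppset (k : nat) (A : {set Idx k}) : #|oppset A| = #|A|.
Proof. by rewrite card_imset //; apply: oppr_inj. Qed.

Lemma card_seq_oppset (k : nat) (A : seq {set Idx k}) :
  card_seq (map (@oppset k) A) = card_seq A.
Proof. by rewrite /card_seq -map_comp; apply: eq_map => S /=; rewrite card_oppset. Qed.

Lemma proper_nonempty_oppset (k : nat) (A : seq {set Idx k}) :
  proper_nonempty (map (@oppset k) A) = proper_nonempty A.
Proof.
rewrite /proper_nonempty all_map; apply: eq_all => S /=.
by rewrite -!cards_eq0 !properEcard !subsetT card_oppset.
Qed.

Lemma pairwise_rev (T : Type) (r : rel T) (s : seq T) :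
  pairwise r (rev s) = pairwise (fun x y => r y x) s.
Proof. by elim: s => //= x s <-; rewrite rev_cons pairwise_rcons all_rev. Qed.

(** The words may differ, as [dec_word] chooses a missing index; the permutations agree because both
    inverses are upshifts of [oppset A]. *)
Lemma opp_dec_word (k : nat) (A : {set Idx k}) : A \proper [set: Idx k] ->
  word_fun (opp_word (dec_word A)) =1 word_fun (dec_word (oppset A)).
Proof.
move=> Apr; have Npr : oppset A \proper [set: Idx k].
  case/properP: Apr => _ [r _ rA]; apply/properP; split; first exact: subsetT.
  by exists (- r); rewrite // in_oppset opprK.
suffices eq_rev : word_fun (rev (opp_word (dec_word A))) =1
    word_fun (rev (dec_word (oppset A))).
  by have := eq_word_fun_rev eq_rev; rewrite !revK.
apply: (@upshift_unique _ (oppset A)); last exact: upshift_dec_word.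
have -> : oppset A = [set i in opp_word (dec_word A)].
  apply/setP => i; rewrite in_oppset -{1}(set_dec_word Apr) !inE.
  by rewrite -{2}[i]opprK mem_map ?mem_rev //; apply: oppr_inj.
apply: upshift_rev; rewrite /cyc_decreasing pairwise_map pairwise_rev.
move: (cyc_decreasing_dec_word Apr); apply: sub_pairwise => i j /= /andP[ji ji1].
rewrite eqr_opp eq_sym ji /=; apply: contraNneq ji1 => eq_i.
by rewrite -[j]opprK -[i]opprK eq_i opprD subrK opprK.
Qed.

Definition ldec_word (k : nat) (A : seq {set Idx k}) : seq (Idx k) :=
  flatten (map (@dec_word k) A).

Lemma opp_ldec_word (k : nat) (A : seq {set Idx k}) : proper_nonempty A ->
  word_fun (opp_word (ldec_word A)) =1 word_fun (rdec_word (map (@oppset k) A)).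
Proof.
elim: A => //= S A IHA /andP[/andP[_ Spr] /IHA{}IHA] m.
rewrite rdec_word_cons /ldec_word /= opp_word_cat !word_fun_cat IHA.
by rewrite opp_dec_word.
Qed.

Lemma size_ldec_word (k : nat) (A : seq {set Idx k}) :
  proper_nonempty A -> size (ldec_word A) = sumn (card_seq A).
Proof.
elim: A => //= S A IHA /andP[/andP[_ Spr] /IHA <-].
by rewrite size_cat size_dec_word.
Qed.

Lemma size_rdec_word (k : nat) (A : seq {set Idx k}) :
  proper_nonempty A -> size (rdec_word A) = sumn (card_seq A).
Proof.
elim: A => //= S A IHA /andP[/andP[_ Spr] /IHA <-].
by rewrite rdec_word_cons size_cat size_dec_word // addnC.
Qed.

Lemma reduced_for_ldec (k : nat) (w : seq (Idx k.+1)) (A : seq {set Idx k.+1}) :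
  proper_nonempty A -> reduced_for w (ldec_word A) <->
    reduced_for (opp_word w) (rdec_word (map (@oppset k.+1) A)).
Proof.
move=> Apr; apply: (iff_trans (reduced_for_opp w _)).
rewrite /reduced_for size_opp_word size_ldec_word // size_rdec_word; last first.
  by rewrite proper_nonempty_oppset.
rewrite card_seq_oppset; split=> -[eq_w ->]; split=> // m.
  by rewrite -opp_ldec_word.
by rewrite opp_ldec_word.
Qed.

Lemma code_plus_oppset (k : nat) (A : seq {set Idx k}) (i : Idx k) :
  code_plus (map (@oppset k) A) i = code_minus A (- i).
Proof.
rewrite !ffunE -!sum1_card big_mkcond [RHS]big_mkcond /=; set n := size A.
have := erefl n; rewrite {1}/n -(size_map (@oppset k)) => eq_n; rewrite eq_n.
apply: eq_bigr => j _; rewrite !inE (nth_map set0) // in_oppset.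
by rewrite opprD.
Qed.

(** * Codes of the canonical decompositions *)

Lemma canonical_rdecE (k : nat) (w : seq (Idx k.+1)) (D : seq {set Idx k.+1} -> Prop) :
  (forall B, D B <-> reduced_for w (rdec_word B)) ->
  forall i, code_minus (canonical D) i = code w (i + 1).
Proof.
move=> DE; have [A [Apr Ared A_code A_max]] := greedy_decomposition w.
rewrite (@canonicalE _ _ A) //; first exact/DE.
by move=> B Bpr /DE; apply: A_max.
Qed.

(** Negates the sets of the greedy decomposition of the opposite word; its code at [- i + 1] is the
    one computed by [code_opp]. *)
Lemma canonical_ldecE (k : nat) (w : seq (Idx k.+1)) (D : seq {set Idx k.+1} -> Prop) :
  (forall B, D B <-> reduced_for w (ldec_word B)) ->
  forall i, code_plus (canonical D) i = code w (res_fun (rev w) i).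
Proof.
move=> DE; have [A [Apr Ared A_code A_max]] := greedy_decomposition (opp_word w).
have oppK : involutive (map (@oppset k.+1)) := mapK (@oppsetK _).
rewrite (@canonicalE _ _ (map (@oppset k.+1) A)) ?proper_nonempty_oppset //.
- by move=> i; rewrite code_plus_oppset A_code addrC code_opp.
- by apply/DE/reduced_for_ldec; rewrite ?proper_nonempty_oppset // oppK.
move=> B Bpr /DE/(reduced_for_ldec w Bpr) Bred; rewrite card_seq_oppset -(card_seq_oppset B).
have [||] := A_max _ _ Bred; [by rewrite proper_nonempty_oppset|by left|].
by move=> <-; right; rewrite oppK.
Qed.

Lemma perm_canonical (k : nat) (w : seq (Idx k.+1)) (Dr Dl : seq {set Idx k.+1} -> Prop) :
  (forall B, Dr B <-> reduced_for w (rdec_word B)) ->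
  (forall B, Dl B <-> reduced_for w (ldec_word B)) ->
  perm_eq (codom (code_minus (canonical Dr))) (codom (code_plus (canonical Dl))).
Proof.
(* Subtracting 1 cancels the shift in [canonical_rdecE], so the left code at i is the right code at
   [sigma i]. *)
move=> DrE DlE; pose sigma i := res_fun (rev w) i - 1.
have sigmaI : injective sigma by move=> i j /addIr/res_fun_inj.
have sigmaE : perm_eq (enum {: Idx k.+1}) (map sigma (enum {: Idx k.+1})).
  apply: uniq_perm => [||i]; first exact: enum_uniq.
    by rewrite map_inj_uniq //; apply: enum_uniq.
  rewrite mem_enum; apply/esym/mapP; exists (invF sigmaI i); rewrite ?mem_enum //.
  by rewrite f_invF.
have -> : codom (code_plus (canonical Dl)) =
    map (code_minus (canonical Dr)) (map sigma (enum {: Idx k.+1})).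
  rewrite -map_comp; apply: eq_map => i /=.
  by rewrite (canonical_rdecE DrE) (canonical_ldecE DlE) subrK.
exact: perm_map.
Qed.

(** * Reduced words and equality in the nil-Coxeter monoid *)

Definition minimal_word (k : nat) (w : seq (Idx k)) : Prop :=
  forall v : seq (Idx k), word_fun v =1 word_fun w -> (size w <= size v)%N.

(** The bound [len_size] is attained by the word of the greedy decomposition. *)
Lemma size_minimal_word (k : nat) (w : seq (Idx k.+1)) :
  minimal_word w -> size w = len w.
Proof.
move=> w_min; apply/eqP; rewrite eqn_leq len_size andbT.
have [A [_ [A_fun <-] _ _]] := greedy_decomposition w.
exact: w_min.
Qed.

(* The invariant that makes equality in the nil-Coxeter monoid sound: minimal
   words are nonzero, and keep their length and the permutation they denote. *)
Definition transfers (k : nat) (u v : option (seq (Idx k))) : Prop :=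
  forall a, u = Some a -> minimal_word a ->
    exists b, [/\ v = Some b, size b = size a & word_fun b =1 word_fun a].

Lemma minimal_word_eq (k : nat) (a b : seq (Idx k)) :
  minimal_word a -> size b = size a -> word_fun b =1 word_fun a -> minimal_word b.
Proof.
by rewrite /minimal_word => a_min -> eq_ba v eq_vb; apply: a_min => m; rewrite eq_vb.
Qed.

Lemma transfers_trans (k : nat) (u v w : option (seq (Idx k))) :
  transfers u v -> transfers v w -> transfers u w.
Proof.
move=> uv vw a ua a_min; have [b [vb sb fb]] := uv a ua a_min.
have [c [wc sc fc]] := vw b vb (minimal_word_eq a_min sb fb).
by exists c; rewrite sc; split=> // m; rewrite fc.
Qed.

Lemma minimal_word_cat (k : nat) (a b : seq (Idx k)) :
  minimal_word (a ++ b) -> minimal_word a /\ minimal_word b.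
Proof.
move=> ab_min; split=> v eq_v.
  have := ab_min (v ++ b); rewrite !size_cat leq_add2r; apply=> m.
  by rewrite !word_fun_cat eq_v.
have := ab_min (a ++ v); rewrite !size_cat leq_add2l; apply=> m.
by rewrite !word_fun_cat eq_v.
Qed.

Lemma transfers_mul (k : nat) (u u' v v' : option (seq (Idx k))) :
  transfers u u' -> transfers v v' -> transfers (mul0w u v) (mul0w u' v').
Proof.
case: u => [a|] //; case: v => [b|] // ua vb _ [<-] /minimal_word_cat[a_min b_min].
have [a' [-> sa fa]] := ua a erefl a_min; have [b' [-> sb fb]] := vb b erefl b_min.
exists (a' ++ b'); rewrite !size_cat sa sb; split=> // m.
by rewrite !word_fun_cat fb fa.
Qed.

Lemma transfers_fun (k : nat) (a b : seq (Idx k)) :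
  size a = size b -> word_fun a =1 word_fun b -> transfers (Some a) (Some b).
Proof. by move=> sab fab _ [<-] _; exists b; split=> // m; rewrite fab. Qed.

Lemma simple_refl_fix (k : nat) (i : Idx k) (m : int) :
  m%:~R != i -> m%:~R != i + 1 -> simple_refl i m = m.
Proof. by rewrite /simple_refl => /negPf-> /negPf->. Qed.

Lemma simple_refl_comm (k : nat) (i j : Idx k) : j \notin [:: i - 1; i; i + 1] ->
  word_fun [:: i; j] =1 word_fun [:: j; i].
Proof.
rewrite !inE !negb_or => /and3P[ij1 ij ij2] m /=.
have ji1 : j + 1 != i by rewrite -(inj_eq (addIr (- 1))) addrK.
have j1i1 : j + 1 != i + 1 by rewrite (inj_eq (addIr 1)).
case: (simple_reflP j m) => [mj|mj|mj mj1].
- by rewrite !(@simple_refl_fix _ i) ?resD1 ?mj // /simple_refl mj eqxx.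
- rewrite !(@simple_refl_fix _ i) ?resB1 ?mj ?addrK //.
  by rewrite /simple_refl mj addr1_neq eqxx.
case: (simple_reflP i m) => [mi|mi|_ _]; last by rewrite simple_refl_fix.
  by rewrite simple_refl_fix // resD1 mi eq_sym.
by rewrite simple_refl_fix // resB1 mi addrK eq_sym // (inj_eq (addIr 1)).
Qed.

(** With period at least 3 the residues i, i + 1, i + 2 are distinct; both sides raise i by two,
    lower i + 2 by two and fix the rest. *)
Lemma simple_refl_braid (k : nat) (i : Idx k.+1) : (2 <= k.+1)%N ->
  word_fun [:: i; i + 1; i] =1 word_fun [:: i + 1; i; i + 1].
Proof.
case: k i => // k i _ m /=.
have i2 : (i + 1 + 1 == i) = false by rewrite -addrA -[X in _ == X]addr0 (inj_eq (addrI i)).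
have i1 := addr1_neq i; have i3 := addr1_neq (i + 1).
have up (j : Idx k.+2) p : p%:~R = j -> simple_refl j p = p + 1.
  by move=> <-; rewrite simple_refl_up.
have down (j : Idx k.+2) p : p%:~R = j + 1 -> simple_refl j p = p - 1.
  by rewrite /simple_refl => ->; rewrite addr1_neq eqxx.
have fix_ (j : Idx k.+2) p : (p%:~R == j) = false -> (p%:~R == j + 1) = false ->
    simple_refl j p = p.
  by move=> pj pj1; rewrite simple_refl_fix ?pj ?pj1.
have [mi|mi] := eqVneq (m%:~R : Idx k.+2) i.
  rewrite (up i m mi) (up (i + 1)) ?resD1 ?mi // (fix_ i (m + 1 + 1)) ?resD1 ?mi //.
  rewrite (fix_ (i + 1) m) ?mi; [|by rewrite eq_sym..].
  by rewrite (up i m mi) (up (i + 1)) ?resD1 ?mi.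
have [mi1|mi1] := eqVneq (m%:~R : Idx k.+2) (i + 1).
  rewrite (down i m mi1) (up (i + 1) m mi1).
  rewrite (fix_ (i + 1) (m - 1)) ?resB1 ?mi1 ?addrK; [|by rewrite eq_sym..].
  rewrite (fix_ i (m + 1)) ?resD1 ?mi1 // (up i (m - 1)) ?resB1 ?mi1 ?addrK //.
  by rewrite (down (i + 1) (m + 1)) ?resD1 ?mi1 //; lia.
rewrite (fix_ i m (negPf mi) (negPf mi1)).
have [mi2|mi2] := eqVneq (m%:~R : Idx k.+2) (i + 1 + 1).
  rewrite (down (i + 1) m mi2) (down i (m - 1)) ?resB1 ?mi2 ?addrK //.
  by rewrite (fix_ (i + 1)) // !resB1 mi2 !addrK eq_sym.
rewrite (fix_ (i + 1) m (negPf mi1) (negPf mi2)).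
by rewrite (fix_ i m (negPf mi) (negPf mi1)) (fix_ (i + 1) m (negPf mi1) (negPf mi2)).
Qed.

(** Both directions are proved at once so that the symmetry rule passes through the induction. *)
Lemma nilcox_transfers (k : nat) (u v : option (seq (Idx k.+1))) :
  nilcox_eq u v -> transfers u v /\ transfers v u.
Proof.
elim=> {u v} [u v [i|i j ij|i k_ge2]|u|u v _ []|u v w _ [uv vu] _ [vw wv]|].
(* The word i i denotes the identity, so it is not minimal and has nothing to transfer. *)
- by split=> // _ [<-] /(_ [::]) /= ii_min; have := ii_min (fun m => esym (simple_reflK i m)).
- by split; apply: transfers_fun => // m; rewrite (simple_refl_comm ij).
- by split; apply: transfers_fun => // m; rewrite (simple_refl_braid i k_ge2).
- by split=> a -> _; exists a.
- by [].
- by split; [apply: transfers_trans uv vw | apply: transfers_trans wv vu].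
- by move=> u u' v v' _ [uu' u'u] _ [vv' v'v]; split; apply: transfers_mul.
Qed.

(** Transfer along the congruence gives one direction; conversely v is itself a reduced word of x
    and serves as the witness. *)
Lemma equals_productP (k : nat) (x : affine_permutation k.+1) (w v : seq (Idx k.+1)) :
  reduced_word x w -> equals_product x v <-> reduced_for w v.
Proof.
move=> [w_x w_min].
have min_x r : reduced_word x r -> minimal_word r.
  by move=> [r_x r_min] a eq_a; apply: r_min => m; rewrite eq_a r_x.
have size_w : size w = len w by apply/size_minimal_word/min_x.
split=> [[r [r_red /nilcox_transfers[rv _]]]|[eq_vw size_v]].
  have [_ [[<-] sv fv]] := rv r erefl (min_x r r_red); have [r_x r_min] := r_red.
  split=> [m|]; first by rewrite fv r_x w_x.
  apply/eqP; rewrite sv -size_w eqn_leq r_min //=; apply: w_min; exact: r_x.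
exists v; split; last exact: NilRefl.
by split=> [m|a /w_min]; rewrite ?eq_vw ?w_x // size_v size_w.
Qed.

(** * Increasing decompositions through the inverse permutation *)

Lemma inc_word_rdec (k : nat) (A : seq {set Idx k}) :
  flatten (rev (map (@inc_word k) A)) = rev (ldec_word A).
Proof. by rewrite /ldec_word rev_flatten -map_comp. Qed.

Lemma inc_word_ldec (k : nat) (A : seq {set Idx k}) :
  flatten (map (@inc_word k) A) = rev (rdec_word A).
Proof. by rewrite /rdec_word rev_flatten map_rev revK -map_comp. Qed.

Lemma minimal_word_rev (k : nat) (w : seq (Idx k)) :
  minimal_word w -> minimal_word (rev w).
Proof.
move=> w_min v /eq_word_fun_rev; rewrite revK => /w_min.
by rewrite !size_rev.
Qed.

Lemma reduced_for_rev (k : nat) (w v : seq (Idx k.+1)) : minimal_word w ->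
  reduced_for w (rev v) <-> reduced_for (rev w) v.
Proof.
move=> w_min; rewrite /reduced_for -!size_minimal_word ?size_rev //; last first.
  exact: minimal_word_rev.
by split=> -[/eq_word_fun_rev]; rewrite ?revK.
Qed.

Theorem proposition43 (k : nat) (hk : (1 <= k)%N) (x : affine_permutation k) :
  perm_eq (codom (RD x)) (codom (LD x)) /\ perm_eq (codom (RI x)) (codom (LI x)).
Proof.
case: k hk x => // k _ x.
(* Were there no reduced word, all four decompositions would be the default [[::]] and all four
   codes zero. *)
have [[w w_red]|no_red] := boolp.EM (exists w, reduced_word x w); last first.
  have void v : ~ equals_product x v by case=> r [r_red _]; apply: no_red; exists r.
  rewrite /RD /LD /RI /LI !canonical_void; try by move=> B; apply: void.
  have -> : code_minus [::] = code_plus [::] :> {ffun Idx k.+1 -> nat}.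
    by apply/ffunP => i; rewrite !ffunE; apply: eq_card => -[].
  by [].
have w_min : minimal_word w.
  by have [w_x min_w] := w_red => v eq_v; apply: min_w => m; rewrite eq_v.
split.
  by apply: (@perm_canonical _ w) => B; apply: equals_productP.
(* Reversal turns left increasing decompositions of x into right decreasing ones of its inverse,
   represented by [rev w]; hence the exchange of sides. *)
rewrite perm_sym; apply: (@perm_canonical _ (rev w)) => B.
- rewrite /linc_decomposition inc_word_ldec.
  by apply: (iff_trans (equals_productP _ w_red)); apply: reduced_for_rev.
- rewrite /rinc_decomposition inc_word_rdec.
  by apply: (iff_trans (equals_productP _ w_red)); apply: reduced_for_rev.
Qed.
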